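(* Let $G$ be a group, let $f:G\to G$ be an injective group homomorphism and let $\mathcal{I}$ be an ideal on $2^{G}$. Then for every subset $A$ of $G$, $f(A^{\propto}(\mathcal{I}))=(f(A))^{\propto}(f(\mathcal{I}))$, where $f(\mathcal{I})=\{f(I): I\in\mathcal{I}\}$.
   Context: For a group $G$, $2^G$ denotes the power set of $G$, viewed as the ring $(2^G,\Delta,\cap)$ with $\Delta$ the symmetric difference as addition and $\cap$ as multiplication. An ideal $\mathcal{I}$ on $G$ (equivalently on $2^G$) is an ideal of this ring; equivalently, a nonempty family of subsets of $G$ closed under taking subsets and under finite unions. For $g\in G$ let $\mathcal{G}(g)$ be the set of all subgroups $H$ of $G$ with $g\in H$. For $A\subseteq G$ and an ideal $\mathcal{I}$ on $G$, $A^{\propto}(\mathcal{I})=\{g\in G: H\cap A\notin\mathcal{I}\text{ for all }H\in\mathcal{G}(g)\}$. For $X\subseteq G$, $f(X)$ denotes the direct image.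
   Formalization: The right-hand side (f(A))^∝(f(I)) is computed in the group f(G) (points and subgroups of f(G)) rather than in G; computed in G the equality fails, e.g. G = Z, f(x) = 2x, I = {∅}, A = Z gives 2Z on the left and Z on the right. *)

(* Defs.v *)
From HB Require Import structures.
From mathcomp Require Import all_boot monoid.
From mathcomp Require Import boolp classical_sets.

Set Implicit Arguments.
Unset Strict Implicit.
Unset Printing Implicit Defensive.

Local Open Scope classical_set_scope.
Local Open Scope group_scope.

(* Groups are arbitrary (possibly infinite): [groupType] of boot/monoid.v, not
   [finGroupType].  The group in which [propto] is computed is an explicit
   subgroup [K] of the type [G]; [K := setT] is the group [G] itself. *)

Definition subgroup (G : groupType) (H : set G) : Prop := group_closed (mem H).

(* Ideals of the ring (2^K, symmetric difference, intersection); not required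
   to be proper. *)
Definition ideal_on (T : Type) (K : set T) (I : set (set T)) : Prop :=
  [/\ forall X, I X -> X `<=` K,
      I set0,
      forall X Y, I X -> I Y -> I (X `+` Y) &
      forall X Y, I X -> Y `<=` K -> I (X `&` Y)].

Definition subgroups_at (G : groupType) (K : set G) (g : G) : set (set G) :=
  [set H | [/\ subgroup H, H `<=` K & H g]].

(* The set A^oc(I), written with a proportionality sign in the literature,
   computed in the group [K].  It depends on [K] and not only on [A] and [I]: a
   family f(I) is an ideal both on f(G) and on G, but f(A^oc(I)) = f(A)^oc(f(I))
   can fail when the right-hand side is computed in G.  For G = Z, f(x) = 2x,
   I = {set0} and A = Z, the point 1 is not in f(G), while the only subgroup
   containing it, Z, meets f(A). *)
Definition propto (G : groupType) (K A : set G) (I : set (set G)) : set G :=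
  [set g | K g /\ forall H, subgroups_at K g H -> ~ I (H `&` A)].

Definition image_ideal (T U : Type) (f : T -> U) (I : set (set T)) :
  set (set U) := [set f @` X | X in I].

Lemma proptoT (G : groupType) (A : set G) (I : set (set G)) :
  propto setT A I =
  [set g | forall H, subgroup H -> H g -> ~ I (H `&` A)].
Proof.
apply/seteqP; split=> g /=.
  by move=> [_ gA] H sH Hg; apply: gA; split.
by move=> gA; split=> // H [sH _ Hg]; apply: gA.
Qed.

(* The next two lemmas make [propto (range f) (f @` A) (image_ideal f I)]
   meaningful: f(G) is a group and f(I) is an ideal on it. *)
Lemma subgroup_range (G : groupType) (f : {multiplicative G -> G}) :
  subgroup (range f).
Proof.
have f1 : f 1 = 1 by apply: (mulgI (f 1)); rewrite -gmulfM !mulg1.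
split; first by apply/mem_set; exists 1.
move=> _ _ /set_mem[x _ <-] /set_mem[y _ <-]; apply/mem_set; exists (x / y) => //.
by apply: (mulIg (f y)); rewrite -gmulfM !mulgVK.
Qed.

Lemma ideal_on_image (T U : Type) (f : T -> U) (I : set (set T)) :
  injective f -> ideal_on setT I -> ideal_on (range f) (image_ideal f I).
Proof.
move=> f_inj [_ I0 IY II]; split.
- by move=> _ [X _ <-] _ [x _ <-]; exists x.
- by exists set0 => //; rewrite image_set0.
- move=> _ _ [X IX <-] [Y IYY <-]; exists (X `+` Y); first exact: IY.
  apply/seteqP; split=> [_ [x [[Xx nYx]|[Yx nXx]] <-]|_ [[[x Xx <-] nY]|[[x Yx <-] nX]]].
  + by left; split; [exists x|move=> [y Yy /f_inj yx]; apply: nYx; rewrite -yx].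
  + by right; split; [exists x|move=> [y Yy /f_inj yx]; apply: nXx; rewrite -yx].
  + by exists x => //; left; split=> // Yx; apply: nY; exists x.
  + by exists x => //; right; split=> // Xx; apply: nX; exists x.
- move=> _ Y [X IX <-] _; exists (X `&` f @^-1` Y); first exact: II.
  apply/seteqP; split=> [_ [x [Xx Yx] <-]|_ [[x Xx <-] Yx]].
  + by split=> //; exists x.
  + by exists x.
Qed.

(* Main.v *)
Require Import Defs.
From HB Require Import structures.
From mathcomp Require Import all_boot monoid.
From mathcomp Require Import boolp classical_sets.

Set Implicit Arguments.
Unset Strict Implicit.
Unset Printing Implicit Defensive.

Local Open Scope classical_set_scope.
Local Open Scope group_scope.

(** An injective homomorphism [f] is an isomorphism of the group onto its range,
    and [propto] is defined from data that an isomorphism carries along.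
    Concretely, subgroups [H] around [g] and subgroups [L] of the range around
    [f g] correspond through [H = f^-1(L)] and [L = f(H)]
    ([subgroups_at_preimage], [subgroups_at_image]).  The projection formula
    [setI_image] says that the trace of [L] on [f(A)] is the image of the trace
    of [f^-1(L)] on [A], and by [image_ideal_image] the image of a set lies in
    the image of the family exactly when the set lies in the family.  So [L]
    witnesses that [f g] is outside the right-hand side if and only if
    [f^-1(L)] witnesses that [g] is outside [propto setT A I], and every [H]
    arises as such an [f^-1(L)], namely for [L = f(H)]
    ([preimage_image_inj]). *)

(** The projection formula: a subset of the image [f(A)] is the image of the
    part of [A] that it pulls back to.  It turns the trace on [f(A)] of any subgroup
    of the range into the image of a set, the form in which membership in the
    image of a family can be tested. *)
Lemma setI_image (T U : Type) (f : T -> U) (L : set U) (A : set T) :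
  L `&` f @` A = f @` (f @^-1` L `&` A).
Proof.
apply/seteqP; split=> [y [Ly [x Ax fxy]]|_ [x [Lx Ax] <-]].
  by exists x => //; split=> //; rewrite /preimage /= fxy.
by split=> //; exists x.
Qed.

Lemma preimage_image_inj (T U : Type) (f : T -> U) (X : set T) :
  injective f -> f @^-1` (f @` X) = X.
Proof.
move=> f_inj; apply/seteqP; split=> [x [y Xy /f_inj <-]|x Xx] //.
by exists x.
Qed.

(** The direction that needs a reason is left to right: a set [Y] of the family
    with the same image as [X] is [X] itself, since injectivity of [f] passes to
    direct images. *)
Lemma image_ideal_image (T U : Type) (f : T -> U) (I : set (set T))
    (X : set T) :
  injective f -> image_ideal f I (f @` X) <-> I X.
Proof.
move=> f_inj; split=> [[Y IY eqYX]|IX]; last by exists X.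
by rewrite -(preimage_image_inj X f_inj) -eqYX preimage_image_inj.
Qed.

(** Multiplicativity alone makes a map between groups preserve units and
    quotients, since the target is cancellative. *)
Lemma multiplicative1 (G H : groupType) (f : {multiplicative G -> H}) : f 1 = 1.
Proof. by apply: (mulgI (f 1)); rewrite -gmulfM !mulg1. Qed.

Lemma multiplicativeF (G H : groupType) (f : {multiplicative G -> H}) :
  {morph f : x y / x / y}.
Proof. by move=> x y; apply: (mulIg (f y)); rewrite -gmulfM !mulgVK. Qed.

Lemma subgroups_at_preimage (G : groupType) (f : {multiplicative G -> G})
    (K L : set G) (g : G) :
  subgroups_at K (f g) L -> subgroups_at setT g (f @^-1` L).
Proof.
move=> [[L1 LV] _ Lfg]; split=> //; split.
  by apply/mem_set; rewrite /preimage /= multiplicative1; apply/set_mem.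
move=> x y /set_mem Lx /set_mem Ly; apply/mem_set.
rewrite /preimage /= multiplicativeF.
by apply/set_mem/LV; apply/mem_set.
Qed.

Lemma subgroups_at_image (G : groupType) (f : {multiplicative G -> G})
    (K H : set G) (g : G) :
  subgroups_at K g H -> subgroups_at (range f) (f g) (f @` H).
Proof.
move=> [[H1 HV] _ Hg]; split; last by exists g.
- split.
    by apply/mem_set; exists 1; [apply/set_mem|rewrite multiplicative1].
  move=> _ _ /set_mem[x Hx <-] /set_mem[y Hy <-]; apply/mem_set.
  by exists (x / y); [apply/set_mem/HV; apply/mem_set|rewrite multiplicativeF].
- by move=> _ [x _ <-]; exists x.
Qed.

Theorem theorem2p16 (G : groupType) (f : {multiplicative G -> G})
    (f_inj : injective f) (I : set (set G)) (I_ideal : ideal_on setT I)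
    (A : set G) :
  f @` propto setT A I = propto (range f) (f @` A) (image_ideal f I).
Proof.
apply/seteqP; split=> [_ [g [_ gA] <-]|_ [[g _ <-] fgA]].
  split=> [|L sL]; first by exists g.
  rewrite setI_image image_ideal_image //.
  exact: gA (subgroups_at_preimage sL).
exists g => //; split=> // H sH IHA.
apply: fgA (subgroups_at_image f sH) _.
by rewrite setI_image preimage_image_inj // image_ideal_image.
Qed.
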